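(* Consider the setting of the context. Assume that for all $k\in\mathbb N$ and $p\in\mathcal P$: (i) (self-loops) $(i,i)\in\mathcal E^{D,k}_p$ for all $i\in\overline{\mathcal N}^E(p)$; (ii) (column-stochasticity) $\mathbf 1_{N_p}^\top W_p^k=\mathbf 1_{N_p}^\top$; (iii) (finite weights) $[W_p^k]_{i,j}\ge\nu$ for all $(j,i)\in\mathcal E^{D,k}_p$, where $\nu>0$ is a constant. Assume also that there is an integer $Q>0$ such that, for all $p\in\mathcal P$, the time-varying graph $(\mathcal G^{D,k}_p)_{k\in\mathbb N}$ is $Q$-strongly connected, i.e. $\bigcup_{t=kQ}^{(k+1)Q-1}\mathcal G^{D,t}_p$ is strongly connected for all $k\in\mathbb N$. Assume that for all $i\in\mathcal I$ the function $f_i:\mathbb R^{n_y}\to\mathbb R$ is convex and that there is $L>0$ such that $\|g_i\|\le L$ for all $i\in\mathcal I$, all $y\in\mathbb R^{n_y}$ and all $g_i\in\partial f_i(y)$. Let $(\gamma^k)_{k\in\mathbb N}$ be a positive non-increasing sequence with $\sum_{k=0}^\infty\gamma^k=\infty$ and $\sum_{k=0}^\infty(\gamma^k)^2<\infty$. Let the sequences be generated, for all $i\in\mathcal I$, $p\in\mathcal N^E(i)$ and $k\in\mathbb N$, by $$q_{i,p}^{k+1}=\sum_{j\in\overline{\mathcal N}^E(p)}[W_p^k]_{i,j}\,q_{j,p}^k,\qquad \boldsymbol w_{i,p}^{k+1}=\sum_{j\in\overline{\mathcal N}^E(p)}[W_p^k]_{i,j}\,\boldsymbol z_{j,p}^k,\qquad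 \boldsymbol y_{i,p}^{k+1}=\frac{\boldsymbol w_{i,p}^{k+1}}{q_{i,p}^{k+1}},$$ $$\operatorname{col}((\boldsymbol g_{i,p}^{k+1})_{p\in\mathcal N^E(i)})\in\partial f_i(\tilde{\boldsymbol y}_i^{k+1}),\qquad \boldsymbol z_{i,p}^{k+1}=\boldsymbol w_{i,p}^{k+1}-\gamma^k\boldsymbol g_{i,p}^{k+1},$$ with arbitrary $\boldsymbol z^0_{i,p}\in\mathbb R^{n_{y_p}}$ and $q^0_{i,p}=1$. Then the sequence $(\boldsymbol y^k)_k$ converges to $\boldsymbol{\mathcal C}(y^\star)$ for some $y^\star\in\mathcal Y^\star$; that is, there is $y^\star\in\mathcal Y^\star$ such that $\boldsymbol y_{i,p}^k\to y_p^\star$ as $k\to\infty$ for all $i\in\mathcal I$ and $p\in\mathcal N^E(i)$.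
   Context: Agents are $\mathcal I=\{1,\dots,N\}$. The optimization variable $y\in\mathbb R^{n_y}$ is partitioned as $y=\operatorname{col}((y_p)_{p\in\mathcal P})$, $\mathcal P=\{1,\dots,P\}$, $y_p\in\mathbb R^{n_{y_p}}$ ($\operatorname{col}$ denotes vertical stacking). Interference graph: a bipartite graph with edge set $\mathcal E^I\subseteq\mathcal P\times\mathcal I$ specifying that $f_i(y)$ depends only on the components $y_p$ with $(p,i)\in\mathcal E^I$; every $p$ has at least one $i$ with $(p,i)\in\mathcal E^I$. Estimate graph (fixed in time): a bipartite graph with edge set $\mathcal E^E\subseteq\mathcal P\times\mathcal I$ with $\mathcal E^I\subseteq\mathcal E^E$. Agent $i$ keeps an estimate $\boldsymbol y_{i,p}\in\mathbb R^{n_{y_p}}$ of $y_p$ iff $(p,i)\in\mathcal E^E$. Write $\mathcal N^E(i)=\{p:(p,i)\in\mathcal E^E\}$, $\overline{\mathcal N}^E(p)=\{i:(p,i)\in\mathcal E^E\}$, $N_p=|\overline{\mathcal N}^E(p)|$. The agents communicate over a time-varying directed graph $\mathcal G^{C,k}=(\mathcal I,\mathcal E^{C,k})$, $k\in\mathbb N$. For each $p$ and $k$ the design graph is a directed graph $\mathcal G_p^{D,k}=(\overline{\mathcal N}^E(p),\mathcal E_p^{D,k})\subseteq\mathcal G^{C,k}$, with weight matrix $W_p^k\in\mathbb R^{N_p\times N_p}$ (rows and columns indexed by the agents in $\overline{\mathcal N}^E(p)$) compliant with it: $[W^k_p]_{i,j}>0$ if $(j,i)\in\mathcal E^{D,k}_p$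 and $[W^k_p]_{i,j}=0$ otherwise (edge $(j,i)$ means $i$ receives from $j$). The union of graphs on the same node set is the graph whose edge set is the union of the edge sets. The problem is $\min_{y\in\mathbb R^{n_y}} f(y):=\sum_{i\in\mathcal I}f_i(y)$, with solution set $\mathcal Y^\star$, assumed nonempty. Since $f_i$ depends only on $(y_p)_{(p,i)\in\mathcal E^I}$, it can also be regarded as a function of $\tilde{\boldsymbol y}_i:=\operatorname{col}((\boldsymbol y_{i,p})_{p\in\mathcal N^E(i)})$; $\partial f_i(\tilde{\boldsymbol y}_i)$ is the convex subdifferential of this function. $\boldsymbol y:=\operatorname{col}\bigl((\operatorname{col}((\boldsymbol y_{i,p})_{i\in\overline{\mathcal N}^E(p)}))_{p\in\mathcal P}\bigr)$ stacks all estimates, and $\boldsymbol{\mathcal C}(y):=\operatorname{col}((\mathbf 1_{N_p}\otimes y_p)_{p\in\mathcal P})$. *)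

(* Defs.v *)
(* MathComp-Analysis; real vectors are column vectors over an arbitrary realType. *)
From HB Require Import structures.
From mathcomp Require Import all_boot all_order all_algebra.
From mathcomp Require Import all_classical all_reals all_analysis.

Set Implicit Arguments.
Unset Strict Implicit.
Unset Printing Implicit Defensive.

Import Order.TTheory GRing.Theory Num.Theory.
Import numFieldNormedType.Exports.

Local Open Scope classical_set_scope.
Local Open Scope ring_scope.

Definition dotv (R : realType) (m : nat) (u v : 'cV[R]_m) : R :=
  \sum_(r < m) u r 0 * v r 0.

(* The library norm of a matrix is the sup norm; this one is Euclidean. *)
Definition norm2 (R : realType) (m : nat) (u : 'cV[R]_m) : R :=
  Num.sqrt (dotv u u).

Definition subdifferential (R : realType) (m : nat) (F : 'cV[R]_m -> R)
    (x : 'cV[R]_m) : set 'cV[R]_m :=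
  [set g | forall x', F x + dotv g (x' - x) <= F x'].

Definition minimizers (R : realType) (m : nat) (F : 'cV[R]_m -> R) :
    set 'cV[R]_m :=
  [set x | forall x', F x <= F x'].

(* Bipartite graphs between components 'I_P and agents 'I_N are sets of pairs
   (p, i). *)
Definition comps_of (P N : nat) (E : {set 'I_P * 'I_N}) (i : 'I_N) : {set 'I_P} :=
  [set p | (p, i) \in E]%SET.

Definition agents_of (P N : nat) (E : {set 'I_P * 'I_N}) (p : 'I_P) : {set 'I_N} :=
  [set i | (p, i) \in E]%SET.

(* A vector of R^{n_y} has type 'cV_(\sum_p n p), with p-th block submxcol y p.
   colset A v is col((v_p)_{p in A}), its blocks in increasing order of p. *)
Definition colset (R : realType) (P : nat) (n : 'I_P -> nat) (A : {set 'I_P})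
    (v : forall p, 'cV[R]_(n p)) :
    'cV[R]_(\sum_(a < #|A|) n (enum_val a)) :=
  \mxcol_(a < #|A|) v (enum_val a).

Definition depends_only_on (R : realType) (P : nat) (n : 'I_P -> nat)
    (f : 'cV[R]_(\sum_(p < P) n p) -> R) (A : {set 'I_P}) :=
  forall y y' : 'cV[R]_(\sum_(p < P) n p),
    (forall p, p \in A -> submxcol y p = submxcol y' p) -> f y = f y'.

(* f regarded as a function of the blocks in A: its value at u is f y for any y
   whose A-blocks are u. The choice of y (one always exists) is irrelevant when
   f depends only on a subset of A. *)
Definition fun_on (R : realType) (P : nat) (n : 'I_P -> nat)
    (f : 'cV[R]_(\sum_(p < P) n p) -> R) (A : {set 'I_P})
    (u : 'cV[R]_(\sum_(a < #|A|) n (enum_val a))) : R :=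
  f (xget 0 [set y | colset A (fun p => submxcol y p) = u]).

Lemma fun_onE (R : realType) (P : nat) (n : 'I_P -> nat)
    (f : 'cV[R]_(\sum_(p < P) n p) -> R) (A B : {set 'I_P})
    (y : 'cV[R]_(\sum_(p < P) n p)) :
  B \subset A -> depends_only_on f B ->
  fun_on f (colset A (fun p => submxcol y p)) = f y.
Proof.
move=> /fintype.subsetP BA fB; rewrite /fun_on; apply: fB => p /BA pA.
case: xgetP => [x _ /= xy|/(_ y) []//].
have := congr1 (fun u => submxcol u (enum_rank_in pA p)) xy.
by rewrite /colset !mxcolK enum_rankK_in.
Qed.

(* col((col((v_{i,p})_{i in agents_of E p}))_p); the entries v i p with (p, i)
   outside E are ignored. *)
Definition stack (R : realType) (P N : nat) (n : 'I_P -> nat)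
    (E : {set 'I_P * 'I_N}) (v : 'I_N -> forall p : 'I_P, 'cV[R]_(n p)) :
    'cV[R]_(\sum_(p < P) \sum_(a < #|agents_of E p|) n p) :=
  \mxcol_(p < P) \mxcol_(a < #|agents_of E p|) v (enum_val a) p.

Definition consensus (R : realType) (P N : nat) (n : 'I_P -> nat)
    (E : {set 'I_P * 'I_N}) (y : 'cV[R]_(\sum_(p < P) n p)) :
    'cV[R]_(\sum_(p < P) \sum_(a < #|agents_of E p|) n p) :=
  stack E (fun (_ : 'I_N) p => submxcol y p).

(* For the digraph with node set A and edge set E, where E is included in A x A;
   (j, i) \in E is an edge from j to i. *)
Definition strongly_connected (N : nat) (A : {set 'I_N}) (E : {set 'I_N * 'I_N}) :=
  forall i j, i \in A -> j \in A -> connect (fun a b => (a, b) \in E) i j.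

Definition Q_strongly_connected (N : nat) (Q : nat) (A : {set 'I_N})
    (E : nat -> {set 'I_N * 'I_N}) :=
  forall k : nat,
    strongly_connected A (\bigcup_(k * Q <= t < k.+1 * Q) E t)%SET.

(* Weights on the node set A are stored in an N x N matrix, of which only the
   A x A submatrix is meaningful; entry (i, j) weighs the edge from j to i. *)
Definition compliant (R : realType) (N : nat) (A : {set 'I_N})
    (E : {set 'I_N * 'I_N}) (W : 'M[R]_N) :=
  forall i j, i \in A -> j \in A ->
    if (j, i) \in E then is_true (0 < W i j) else W i j = 0.

Definition column_stochastic (R : realType) (N : nat) (A : {set 'I_N})
    (W : 'M[R]_N) :=
  forall j, j \in A -> \sum_(i in A) W i j = 1.

(* Main.v *)
(* Dividing the push-sum iterates by their weights turns the column-stochastic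
   mixing into a perturbed averaging u(k+1) = S_k u(k) + O(gamma_k) with S_k
   row-stochastic and bounded below on the edges. Over (N+1)Q steps every entry
   of the product is bounded below, so the spread max u - min u contracts up to
   an O(gamma_k) error; hence it is square summable.
   The averages X_p(k) of the z_{i,p}(k) then perform a subgradient step on the
   sum of the f_i, evaluated at points whose distance to X(k) is square
   summable. In the norm weighting block p by N_p, the squared distance of X(k)
   to any minimizer decreases by 2 gamma_k (F(X(k)) - min F) up to a summable
   error. As sum gamma_k = oo, some cluster point of X(k) is a minimizer, and
   the distance to that minimizer tends to 0. *)
Require Import Defs.
From mathcomp Require Import all_boot all_order all_algebra.
From mathcomp Require Import all_classical all_reals all_analysis.
From mathcomp Require Import ring lra.

Set Implicit Arguments.
Unset Strict Implicit.
Unset Printing Implicit Defensive.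

Import Order.TTheory GRing.Theory Num.Theory.
Import numFieldNormedType.Exports.

Local Open Scope classical_set_scope.
Local Open Scope ring_scope.

(** * Spreading along Q-strongly connected graphs *)

Lemma connect_exit (T : finType) (e : rel T) (B : {set T}) (x y : T) :
  connect e x y -> x \in B -> y \notin B ->
  exists a b, [/\ a \in B, b \notin B & e a b].
Proof.
case/connectP=> s; elim: s x => [|c s IH] x /=; first by move=> _ -> ->.
case/andP=> exc es yE xB yB; have [cB|cB] := boolP (c \in B).
  exact: IH es yE cB yB.
by exists x, c.
Qed.

Lemma mem_bigcup_nat (T : finType) (E : nat -> {set T}) (m n : nat) (x : T) :
  x \in (\bigcup_(m <= t < n) E t)%SET -> exists2 t, (m <= t < n)%N & x \in E t.
Proof.
rewrite big_nat_cond; elim/big_rec: _ => [|t U]; first by rewrite inE.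
by rewrite andbT => tmn IH /finset.setUP[|//]; exists t.
Qed.

Section Reachability.
Variables (R : realType) (N : nat) (A : {set 'I_N}).
Variable E : nat -> {set 'I_N * 'I_N}.
Variables (Q : nat) (mu : R).
Hypothesis EA : forall t, E t \subset finset.setX A A.
Hypothesis loops : forall t i, i \in A -> (i, i) \in E t.
Hypothesis Qsc : Q_strongly_connected Q A E.
Hypothesis Q_gt0 : (0 < Q)%N.
Hypothesis mu_gt0 : 0 < mu.

(* After the start is aligned with a multiple of Q, each window of Q steps
   reaches at least one new node, so N windows reach all of A. *)
Lemma reach_all (k : nat) (x : nat -> 'I_N -> R) (i j : 'I_N) :
  (forall t a b, (k <= t)%N -> (a, b) \in E t -> mu * x t a <= x t.+1 b) ->
  i \in A -> j \in A ->
  mu ^+ (N.+1 * Q) * x k j <= x (k + N.+1 * Q)%N i.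
Proof.
move=> xE iA jA.
(* Self-loops make these sets increasing in [t], and an edge active at time [k + t] carries
   membership on to step [t.+1]. *)
pose reached t := [set a in A | mu ^+ t * x k j <= x (k + t)%N a]%SET.
have step t a b : (a, b) \in E (k + t)%N -> a \in reached t -> b \in reached t.+1.
  move=> abE; rewrite !inE => /andP[_ xa].
  have /fintype.subsetP/(_ _ abE) := EA (k + t)%N.
  rewrite finset.in_setX => /andP[_ ->] /=.
  rewrite addnS exprS -mulrA.
  by apply: le_trans (xE _ _ _ (leq_addr _ _) abE); rewrite ler_pM2l.
have mono t s : (t <= s)%N -> reached t \subset reached s.
  elim: s => [|s IH]; first by rewrite leqn0 => /eqP ->.
  rewrite leq_eqVlt => /predU1P[->//|/IH] /fintype.subset_trans; apply.
  apply/fintype.subsetP => a ar; apply: (step _ a) => //; apply: loops.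
  by move: ar; rewrite inE => /andP[].
(* Waiting time until the first multiple of [Q] after [k], where a connectivity window opens. *)
pose r0 := ((k %/ Q).+1 * Q - k)%N.
have kr0 : (k + r0 = (k %/ Q).+1 * Q)%N.
  by rewrite /r0 subnKC // mulSn addnC {1}(divn_eq k Q) leq_add2l ltnW ?ltn_pmod.
have r0Q : (r0 <= Q)%N.
  rewrite -(leq_add2l k) kr0 mulSn addnC leq_add2r; exact: leq_trunc_div.
have jr0 : j \in reached 0%N by rewrite inE jA expr0 mul1r addn0 /=.
have jr t : j \in reached t by apply: (fintype.subsetP (mono 0%N t _)).
have grow l : (minn l.+1 #|A| <= #|reached (r0 + l * Q)|)%N.
  elim: l => [|l IH].
    apply: leq_trans (geq_minl _ _) _; apply/card_gt0P; exists j; exact: jr.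
  have [le|Ar] := boolP (A \subset reached (r0 + l * Q)).
    apply: leq_trans (geq_minr _ _) _; apply: subset_leq_card.
    apply: fintype.subset_trans le (mono _ _ _).
    by rewrite leq_add2l leq_mul2r leqnSn orbT.
  (* The union graph over the window has an edge leaving the reached set. Its tail is still reached
     when the edge is active, so its head is reached by the end of the window. *)
  have /subsetPn[b bA bN] := Ar.
  have /connect_exit/(_ (jr (r0 + l * Q)%N) bN)[a [c [ar cN]]] /= :=
    Qsc ((k %/ Q).+1 + l) jA bA.
  have -> : (((k %/ Q).+1 + l) * Q = k + (r0 + l * Q))%N by rewrite addnA kr0 mulnDl.
  have -> : (((k %/ Q).+1 + l).+1 * Q = k + (r0 + l.+1 * Q))%N.
    by rewrite addnA kr0 -addnS mulnDl.
  move=> /mem_bigcup_nat[t /andP[t1 t2] acE].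
  have kt : (k <= t)%N by rewrite (leq_trans _ t1) ?leq_addr.
  have aW : a \in reached (t - k)%N.
    by apply: (fintype.subsetP (mono _ _ _)) ar; rewrite leq_subRL.
  have ct : c \in reached (t - k).+1 by apply: step aW; rewrite subnKC.
  suff : (#|reached (r0 + l * Q)| < #|reached (r0 + l.+1 * Q)|)%N.
    move=> lt; apply: leq_trans (leq_ltn_trans IH lt).
    by rewrite -minnSS leq_min geq_minl (leq_trans (geq_minr _ _)).
  apply: fintype.proper_card; apply/fintype.properP; split.
    by apply: mono; rewrite leq_add2l leq_mul2r leqnSn orbT.
  exists c => //; apply: (fintype.subsetP (mono _ _ _)) ct.
  by rewrite -subSn // leq_subLR.
(* [N] windows suffice since [#|A| <= N]; the remaining [Q] steps in [N.+1 * Q] cover [r0]. *)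
have full : A \subset reached (r0 + N * Q).
  suff -> : A = reached (r0 + N * Q) by [].
  apply/eqP; rewrite eq_sym eqEcard; apply/andP; split.
    by apply/fintype.subsetP => a; rewrite inE => /andP[].
  have := grow N; suff /minn_idPr -> : (#|A| <= N.+1)%N by [].
  by rewrite ltnW // ltnS (leq_trans (max_card _)) ?card_ord.
have /(fintype.subsetP full) iR := iA.
have : i \in reached (N.+1 * Q)%N.
  by apply: (fintype.subsetP (mono _ _ _)) iR; rewrite mulSn leq_add2r.
by rewrite inE => /andP[].
Qed.
End Reachability.

(** * Bounded partial sums and perturbed averaging *)

(** For nonnegative terms this is summability, in a form that termwise bounds and finite sums
    preserve directly. *)
Definition psum_bounded (R : realType) (a : nat -> R) :=
  exists B, forall n, \sum_(0 <= k < n) a k <= B.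

Section BoundedPartialSums.
Variable R : realType.
Implicit Types a b : nat -> R.

Lemma psum_bounded_le a b :
  (forall k, a k <= b k) -> psum_bounded b -> psum_bounded a.
Proof.
by move=> ab [B bB]; exists B => n; apply: le_trans (bB n); apply: ler_sum.
Qed.

Lemma psum_boundedD a b :
  psum_bounded a -> psum_bounded b -> psum_bounded (fun k => a k + b k).
Proof.
by move=> [B aB] [C bC]; exists (B + C) => n; rewrite big_split/= lerD.
Qed.

Lemma psum_boundedZ a (c : R) :
  0 <= c -> psum_bounded a -> psum_bounded (fun k => c * a k).
Proof.
by move=> c0 [B aB]; exists (c * B) => n; rewrite -mulr_sumr ler_wpM2l.
Qed.

Lemma psum_bounded_sum (I : finType) (P : pred I) (a : I -> nat -> R) :
  (forall i, P i -> psum_bounded (a i)) ->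
  psum_bounded (fun k => \sum_(i | P i) a i k).
Proof.
move=> aB; have /choice[B aBE] i :
    exists B, P i -> forall n, \sum_(0 <= k < n) a i k <= B.
  by case: (boolP (P i)) => [/aB[B]|_]; [exists B | exists 0].
by exists (\sum_(i | P i) B i) => n; rewrite exchange_big ler_sum // => i /aBE.
Qed.

(** Past an index whose partial sum is within [e] of the supremum, less than [e] remains to be
    added. *)
Lemma psum_bounded_tail a (e : R) :
  (forall k, 0 <= a k) -> psum_bounded a -> 0 < e ->
  exists m, forall n, (m <= n)%N -> \sum_(m <= k < n) a k < e.
Proof.
move=> a0 [B aB] e0.
have ubS : has_ubound (range (fun n => \sum_(0 <= k < n) a k)).
  by exists B => _ [n _ <-].
have supS : has_sup (range (fun n => \sum_(0 <= k < n) a k)).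
  by split => //; exists (\sum_(0 <= k < 0) a k), 0%N.
have [_ [m _ <-] lt] := sup_adherent e0 supS.
exists m => n mn; have := sup_upper_bound supS (imageT _ n) => /=.
by rewrite (big_cat_nat (leq0n m) mn)/=; lra.
Qed.

Lemma psum_bounded_small a (e : R) :
  (forall k, 0 <= a k) -> psum_bounded a -> 0 < e ->
  exists m, forall k, (m <= k)%N -> a k < e.
Proof.
move=> a0 aB /(psum_bounded_tail a0 aB)[m me]; exists m => k mk.
apply: le_lt_trans (me k.+1 (leqW mk)); rewrite big_nat_recr //=.
by rewrite lerDr sumr_ge0.
Qed.

(** Sum the recursion: shifting by [T] loses only the first [T] terms, so [eta] times a partial sum
    of [a] is at most those terms plus the bound on [b]. *)
Lemma psum_bounded_contraction a b (T : nat) (eta : R) :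
  0 < eta -> (forall k, 0 <= a k) ->
  (forall k, a (k + T)%N <= (1 - eta) * a k + b k) ->
  psum_bounded b -> psum_bounded a.
Proof.
move=> eta0 a0 aT [B bB]; exists ((\sum_(0 <= k < T) a k + B) / eta) => n.
rewrite ler_pdivlMr //.
have : \sum_(0 <= k < n) a k <= \sum_(0 <= k < n + T) a k.
  by rewrite (big_cat_nat (leq0n n) (leq_addr T n))/= lerDl sumr_ge0.
rewrite (big_cat_nat (leq0n T) (leq_addl n T))/= -{2}[T]add0n big_addn addnK.
have : \sum_(0 <= k < n) a (k + T)%N <=
    (1 - eta) * \sum_(0 <= k < n) a k + \sum_(0 <= k < n) b k.
  by rewrite mulr_sumr -big_split/= ler_sum.
move: (bB n); lra.
Qed.
End BoundedPartialSums.

Section Spread.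
Variables (R : realType) (N : nat) (A : {set 'I_N}).
Implicit Type u : 'I_N -> R.

(** This is max [u] - min [u] over a nonempty [A]. Over pairs all terms are nonnegative, so the
    default 0 is harmless. *)
Definition spread u :=
  \big[Num.max/0]_(ij : 'I_N * 'I_N | (ij.1 \in A) && (ij.2 \in A))
     `|u ij.1 - u ij.2|.

Lemma ler_spread u i j : i \in A -> j \in A -> `|u i - u j| <= spread u.
Proof.
move=> iA jA; rewrite /spread.
by apply: (le_bigmax_cond _ (j := (i, j)) (fun ij => `|u ij.1 - u ij.2|)); rewrite /= iA.
Qed.

Lemma spread_le u b :
  0 <= b -> (forall i j, i \in A -> j \in A -> u i - u j <= b) -> spread u <= b.
Proof.
move=> b0 ub; apply: bigmax_le => // -[i j] /andP[/= iA jA].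
by rewrite ler_norml lerNl opprB !ub.
Qed.

Lemma spread_ge0 u : 0 <= spread u.
Proof. exact: bigmax_ge_id. Qed.
End Spread.

(** * Contraction of the spread under inexact averaging *)

Section PerturbedAveraging.
Variables (R : realType) (N : nat) (A : {set 'I_N}).
Variable E : nat -> {set 'I_N * 'I_N}.
Variables (Q : nat) (mu : R).
Hypothesis EA : forall t, E t \subset finset.setX A A.
Hypothesis loops : forall t i, i \in A -> (i, i) \in E t.
Hypothesis Qsc : Q_strongly_connected Q A E.
Hypothesis Q_gt0 : (0 < Q)%N.
Hypothesis mu_gt0 : 0 < mu.
Hypothesis mu_le1 : mu <= 1.
Variables (S : nat -> 'I_N -> 'I_N -> R) (eps : nat -> R).
Hypothesis S_ge0 : forall k i j, i \in A -> j \in A -> 0 <= S k i j.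
Hypothesis S_row : forall k i, i \in A -> \sum_(j in A) S k i j = 1.
Hypothesis S_mu : forall k i j, (j, i) \in E k -> mu <= S k i j.
Hypothesis eps_ge0 : forall k, 0 <= eps k.

Let T := (N.+1 * Q)%N.

Definition averaging (u : nat -> 'I_N -> R) :=
  forall k i, i \in A -> `|u k.+1 i - \sum_(j in A) S k i j * u k j| <= eps k.

Lemma averagingN u : averaging u -> averaging (fun k i => - u k i).
Proof.
move=> uS k i iA; rewrite -normrN opprB; under eq_bigr do rewrite mulrN.
by rewrite sumrN opprK addrC uS.
Qed.

(** Subtracting [m] and adding the errors accumulated so far gives a nonnegative family that
    dominates its exact averages, so it keeps at least the fraction [mu] along each edge and
    [reach_all] applies. *)
Lemma averaging_lower u k m i j : averaging u ->
  (forall a, a \in A -> m <= u k a) -> i \in A -> j \in A ->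
  m + mu ^+ T * (u k j - m) - \sum_(k <= s < k + T) eps s <= u (k + T)%N i.
Proof.
move=> uS mu_ iA jA.
pose x t a := u t a - m + \sum_(k <= s < t) eps s.
have xS t a : (k <= t)%N -> a \in A -> \sum_(b in A) S t a b * x t b <= x t.+1 a.
  move=> kt aA; rewrite /x big_nat_recr //=.
  under eq_bigr do rewrite -addrA mulrDr.
  rewrite big_split/= -mulr_suml S_row // mul1r.
  have := uS t a aA; rewrite ler_norml => /andP[+ _]. lra.
have x0 t a : (k <= t)%N -> a \in A -> 0 <= x t a.
  elim: t a => [|t IH] a.
    by rewrite leqn0 => /eqP k0 aA; rewrite /x -k0 big_geq // addr0 subr_ge0 mu_.
  rewrite leq_eqVlt => /predU1P[<- aA|kt aA].
    by rewrite /x big_geq // addr0 subr_ge0 mu_.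
  apply: le_trans (xS _ _ kt aA); apply: sumr_ge0 => b bA.
  by rewrite mulr_ge0 ?S_ge0 ?IH.
have xE t a b : (k <= t)%N -> (a, b) \in E t -> mu * x t a <= x t.+1 b.
  move=> kt abE; have /fintype.subsetP/(_ _ abE) := EA t.
  rewrite finset.in_setX => /andP[/= aA bA].
  apply: le_trans (xS _ _ kt bA); rewrite (bigD1 a) //=.
  apply: ler_wpDr; last by rewrite ler_wpM2r ?x0 ?S_mu.
  by apply: sumr_ge0 => c /andP[cA _]; rewrite mulr_ge0 ?S_ge0 ?x0.
have := reach_all EA loops Qsc Q_gt0 mu_gt0 xE iA jA.
by rewrite /x big_geq // addr0 -/T; lra.
Qed.

(** The node attaining the maximum lifts every later value above the old minimum by the fraction
    [mu ^+ T] of the spread. For [- u] the source is its own minimizer, so there is no gain: the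
    maximum just rises by at most the accumulated error. *)
Lemma spread_contraction u k : averaging u ->
  spread A (u (k + T)%N) <=
    (1 - mu ^+ T) * spread A (u k) + 2 * \sum_(k <= s < k + T) eps s.
Proof.
move=> uS; have eta1 : mu ^+ T <= 1 by rewrite exprn_ile1 // ltW.
apply: spread_le => [|j i jA iA].
  by rewrite addr_ge0 ?mulr_ge0 ?subr_ge0 ?spread_ge0 ?sumr_ge0.
pose a := [arg min_(a < i in A) u k a]%O; pose b := [arg max_(a > i in A) u k a]%O.
have [aA amin] : a \in A /\ forall c, c \in A -> u k a <= u k c.
  by rewrite /a; case: arg_minP.
have [bA bmax] : b \in A /\ forall c, c \in A -> u k c <= u k b.
  by rewrite /b; case: arg_maxP.
have := averaging_lower uS amin iA bA.
have bmin c : c \in A -> - u k b <= - u k c by rewrite lerN2; apply: bmax.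
have := averaging_lower (averagingN uS) bmin jA bA; rewrite subrr mulr0 addr0.
have := ler_spread (u k) bA aA; rewrite ger0_norm ?subr_ge0 ?bmax // => sp.
have : (1 - mu ^+ T) * (u k b - u k a) <= (1 - mu ^+ T) * spread A (u k).
  by rewrite ler_wpM2l // subr_ge0.
lra.
Qed.

Lemma spread_sqr_summable u : nonincreasing_seq eps ->
  psum_bounded (fun k => eps k ^+ 2) -> averaging u ->
  psum_bounded (fun k => spread A (u k) ^+ 2).
Proof.
move=> epsN eps2 uS; set eta := mu ^+ T.
have eta0 : 0 < eta by rewrite exprn_gt0.
have eta1 : eta <= 1 by rewrite exprn_ile1 // ltW.
(* Scaled so that the error [2 * T * eps k] equals [eta * (K * eps k)]; the new spread is then
   bounded by a convex combination. *)
pose K := 2 * T%:R / eta.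
apply: (@psum_bounded_contraction _ _
  (fun k => eta * K ^+ 2 * eps k ^+ 2) T eta) => //.
- by move=> k; rewrite exprn_ge0 ?spread_ge0.
- move=> k.
  have : spread A (u (k + T)%N) <=
      (1 - eta) * spread A (u k) + eta * (K * eps k).
    apply: le_trans (spread_contraction k uS) _; rewrite lerD2l.
    have -> : eta * (K * eps k) = 2 * (T%:R * eps k).
      by rewrite /K; field; rewrite gt_eqF.
    rewrite ler_wpM2l // -[T in T%:R](addKn k) mulr_natl -sumr_const_nat.
    by apply: ler_sum_nat => s /andP[ks _]; apply: epsN.
  have := spread_ge0 A (u (k + T)%N).
  have := spread_ge0 A (u k); have : 0 <= K * eps k.
    by rewrite mulr_ge0 // divr_ge0 ?mulr_ge0 // ltW.
  rewrite -[eta * K ^+ 2 * _]mulrA -exprMn.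
  move: (K * eps k) (spread A (u k)) (spread A (u (k + T)%N)) => e D D' e0 D0 D'0 le.
  have : D' ^+ 2 <= ((1 - eta) * D + eta * e) ^+ 2.
    by rewrite ler_sqr ?nnegrE //; apply: le_trans le.
  (* The convexity gap of the square with weights [1 - eta] and [eta]. *)
  have : 0 <= (1 - eta) * eta * (D - e) ^+ 2.
    by rewrite mulr_ge0 ?sqr_ge0 // mulr_ge0 ?subr_ge0 // ltW.
  rewrite !expr2; lra.
- by apply: psum_boundedZ => //; rewrite mulr_ge0 ?sqr_ge0 // ltW.
Qed.
End PerturbedAveraging.

(** * Push-sum *)

(** As both weights have total 1, the difference is the average of [u i - u j] under the product
    weights [a i * b j]. *)
Lemma ler_spread_weighted (R : realType) (N : nat) (A : {set 'I_N})
    (u a b : 'I_N -> R) :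
  (forall i, i \in A -> 0 <= a i) -> (forall i, i \in A -> 0 <= b i) ->
  \sum_(i in A) a i = 1 -> \sum_(i in A) b i = 1 ->
  `|\sum_(i in A) a i * u i - \sum_(i in A) b i * u i| <= spread A u.
Proof.
move=> a0 b0 a1 b1.
have -> : \sum_(i in A) a i * u i - \sum_(i in A) b i * u i =
    \sum_(i in A) \sum_(j in A) a i * b j * (u i - u j).
  under [RHS]eq_bigr do under eq_bigr do rewrite mulrBr.
  under [RHS]eq_bigr do rewrite sumrB.
  rewrite sumrB; congr (_ - _).
    by apply: eq_bigr => i _; rewrite -mulr_suml -mulr_sumr b1 mulr1.
  rewrite exchange_big; apply: eq_bigr => j _ /=.
  by rewrite -mulr_suml -mulr_suml a1 mul1r.
apply: le_trans (ler_norm_sum _ _ _) _.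
have -> : spread A u = \sum_(i in A) \sum_(j in A) a i * b j * spread A u.
  under eq_bigr do rewrite -mulr_suml -mulr_sumr b1 mulr1.
  by rewrite -mulr_suml a1 mul1r.
apply: ler_sum => i iA; apply: le_trans (ler_norm_sum _ _ _) _.
apply: ler_sum => j jA; rewrite normrM ger0_norm ?mulr_ge0 ?a0 ?b0 //.
by rewrite ler_wpM2l ?mulr_ge0 ?a0 ?b0 ?ler_spread.
Qed.

Section PushSum.
Variables (R : realType) (N : nat) (A : {set 'I_N}).
Variable E : nat -> {set 'I_N * 'I_N}.
Variables (Q : nat) (nu : R) (W : nat -> 'M[R]_N).
Hypothesis EA : forall t, E t \subset finset.setX A A.
Hypothesis loops : forall t i, i \in A -> (i, i) \in E t.
Hypothesis Qsc : Q_strongly_connected Q A E.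
Hypothesis Q_gt0 : (0 < Q)%N.
Hypothesis nu_gt0 : 0 < nu.
Hypothesis W_compliant : forall k, compliant A (E k) (W k).
Hypothesis W_col : forall k, column_stochastic A (W k).
Hypothesis W_nu : forall k i j, (j, i) \in E k -> nu <= W k i j.
Variable q : nat -> 'I_N -> R.
Hypothesis q0 : forall i, i \in A -> q 0%N i = 1.
Hypothesis qS : forall k i, i \in A -> q k.+1 i = \sum_(j in A) W k i j * q k j.

Let T := (N.+1 * Q)%N.

Lemma weight_ge0 k i j : i \in A -> j \in A -> 0 <= W k i j.
Proof.
move=> iA jA; have := W_compliant k iA jA.
by case: ifP => _; [apply: ltW | move=> ->].
Qed.

Lemma nu_le1 i : i \in A -> nu <= 1.
Proof.
move=> iA; apply: le_trans (W_nu (loops 0%N iA)) _.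
rewrite -(W_col 0%N iA) (bigD1 i) //= lerDl sumr_ge0 // => j /andP[jA _].
exact: weight_ge0.
Qed.

Lemma column_sum (x : 'I_N -> R) k :
  \sum_(i in A) \sum_(j in A) W k i j * x j = \sum_(j in A) x j.
Proof.
rewrite exchange_big; apply: eq_bigr => j jA /=.
by rewrite -mulr_suml (W_col k jA) mul1r.
Qed.

Lemma pushsum_mass k : \sum_(i in A) q k i = #|A|%:R.
Proof.
elim: k => [|k <-].
  by rewrite (eq_bigr (fun=> 1)) ?sumr_const // => i /q0.
by rewrite -[RHS](column_sum _ k); apply: eq_bigr => i /qS.
Qed.

Lemma pushsum_ge0 k i : i \in A -> 0 <= q k i.
Proof.
elim: k i => [|k IH] i iA; first by rewrite q0.
by rewrite qS // sumr_ge0 // => j jA; rewrite mulr_ge0 ?weight_ge0 ?IH.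
Qed.

Lemma pushsum_edge k i j : (j, i) \in E k -> nu * q k j <= q k.+1 i.
Proof.
move=> jiE; have /fintype.subsetP/(_ _ jiE) := EA k.
rewrite finset.in_setX => /andP[/= jA iA]; rewrite qS // (bigD1 j) //=.
apply: ler_wpDr; last by rewrite ler_wpM2r ?pushsum_ge0 ?W_nu.
by apply: sumr_ge0 => c /andP[cA _]; rewrite mulr_ge0 ?weight_ge0 ?pushsum_ge0.
Qed.

(** Before time [T] the self-loops alone keep [nu ^+ k]. Later, the total mass [#|A|] forces some
    node to hold at least 1 at time [k - T], and [reach_all] spreads that mass to [i]. *)
Lemma pushsum_lower k i : i \in A -> nu ^+ T <= q k i.
Proof.
move=> iA; have nu1 := nu_le1 iA; have [kT|Tk] := ltnP k T.
  apply: (@le_trans _ _ (nu ^+ k)); first by rewrite ler_wiXn2l ?(ltW nu_gt0) ?(ltnW kT).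
  elim: k {kT} => [|k IH]; first by rewrite q0.
  apply: le_trans (pushsum_edge (loops k iA)).
  by rewrite exprS ler_pM2l.
have [j jA qj] : exists2 j, j \in A & 1 <= q (k - T)%N j.
  apply: contrapT => /forall2NP qlt.
  suff : \sum_(j in A) q (k - T)%N j < \sum_(j in A) 1.
    by rewrite pushsum_mass sumr_const ltxx.
  have lt1 j : j \in A -> q (k - T)%N j < 1.
    by move=> jA; have [//|/negP] := qlt j; rewrite -ltNge.
  rewrite (bigD1 i) //= [ltRHS](bigD1 i) //= ltr_leD ?lt1 //.
  by apply: ler_sum => j /andP[jA _]; rewrite ltW ?lt1.
have := reach_all EA loops Qsc Q_gt0 nu_gt0 (k := (k - T)%N) (x := q)
  (fun t a b _ abE => pushsum_edge abE) iA jA.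
rewrite subnK //; apply: le_trans.
by rewrite -[leLHS]mulr1 ler_wpM2l // exprn_ge0 // ltW.
Qed.

Lemma pushsum_upper k i : i \in A -> q k i <= #|A|%:R.
Proof.
move=> iA; rewrite -(pushsum_mass k) (bigD1 i) //= lerDl sumr_ge0 // => j /andP[jA _].
exact: pushsum_ge0.
Qed.

(** The mean of [z k] and the value [y k.+1 i] are both convex combinations of the ratios
    [z k j / q k j], with weights [q k j / #|A|] and [S k i j]. They differ by at most the spread of
    these ratios. *)
Lemma pushsum_consensus (z y : nat -> 'I_N -> R) (eps : nat -> R) :
  (forall k, 0 <= eps k) -> nonincreasing_seq eps ->
  psum_bounded (fun k => eps k ^+ 2) ->
  (forall k i, i \in A -> y k.+1 i = (q k.+1 i)^-1 * \sum_(j in A) W k i j * z k j) ->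
  (forall k i, i \in A -> `|z k.+1 i - \sum_(j in A) W k i j * z k j| <= eps k) ->
  forall i, i \in A ->
  psum_bounded (fun k => (#|A|%:R^-1 * \sum_(j in A) z k j - y k.+1 i) ^+ 2).
Proof.
move=> eps0 epsN eps2 yE zE i0 i0A; set n : R := #|A|%:R; set c := nu ^+ T.
have c0 : 0 < c by rewrite exprn_gt0.
have n1 : 1 <= n by rewrite ler1n; apply/card_gt0P; exists i0.
have n0 : 0 < n by rewrite (lt_le_trans _ n1).
have q_gt0 k i : i \in A -> 0 < q k i.
  by move=> iA; rewrite (lt_le_trans c0) ?pushsum_lower.
(* Lower bound for [S] on edges: [W] is at least [nu], [q k j] at least [c], and [q k.+1 i] at most
   [n]. *)
pose mu := nu * c / n.
have mu0 : 0 < mu by rewrite divr_gt0 ?mulr_gt0.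
have nu1 := nu_le1 i0A.
have mu1 : mu <= 1.
  rewrite ler_pdivrMr // mul1r (le_trans _ n1) //.
  by rewrite mulr_ile1 ?exprn_ile1 // ltW.
pose S k i j := W k i j * q k j / q k.+1 i.
pose u k j := z k j / q k j.
have S_ge0 k i j : i \in A -> j \in A -> 0 <= S k i j.
  by move=> iA jA; rewrite divr_ge0 ?mulr_ge0 ?weight_ge0 ?pushsum_ge0.
have S_row k i : i \in A -> \sum_(j in A) S k i j = 1.
  by move=> iA; rewrite -mulr_suml -qS // divff // gt_eqF ?q_gt0.
have S_mu k i j : (j, i) \in E k -> mu <= S k i j.
  move=> jiE; have /fintype.subsetP/(_ _ jiE) := EA k.
  rewrite finset.in_setX => /andP[/= jA iA].
  apply: ler_pM.
  - by rewrite mulr_ge0 // ltW.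
  - by rewrite invr_ge0 ltW.
  - by rewrite ler_pM ?pushsum_lower ?W_nu // ltW.
  - by rewrite lef_pV2 ?posrE ?q_gt0 ?pushsum_upper.
have Su k i : i \in A -> \sum_(j in A) S k i j * u k j = y k.+1 i.
  move=> iA; rewrite yE // mulr_sumr; apply: eq_bigr => j jA.
  by rewrite /S /u; field; rewrite !gt_eqF ?q_gt0.
(* The averaging error of [u] is that of [z] divided by [q k.+1 i], which is at least [c]. *)
have uS : averaging A S (fun k => c^-1 * eps k) u.
  move=> k i iA; rewrite Su // yE // /u [_ / _]mulrC -mulrBr normrM.
  apply: ler_pM => //; last exact: zE.
  rewrite ger0_norm ?invr_ge0 ?lef_pV2 ?posrE ?q_gt0 ?pushsum_lower //.
  by rewrite ltW ?q_gt0.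
apply: psum_bounded_le (spread_sqr_summable EA loops Qsc Q_gt0 mu0 mu1 S_ge0 S_row
  S_mu _ _ _ uS).
- move=> k /=; rewrite -[leLHS]ger0_norm ?sqr_ge0 // normrX.
  rewrite ler_sqr ?nnegrE ?spread_ge0 //.
  have -> : n^-1 * \sum_(j in A) z k j = \sum_(j in A) n^-1 * q k j * u k j.
    rewrite mulr_sumr; apply: eq_bigr => j jA.
    by rewrite /u; field; rewrite !gt_eqF ?q_gt0.
  rewrite -(Su k i0 i0A); apply: ler_spread_weighted => [i iA|i iA||].
  + by rewrite mulr_ge0 ?invr_ge0 ?pushsum_ge0 // ltW.
  + exact: S_ge0.
  + by rewrite -mulr_sumr pushsum_mass mulVf // gt_eqF.
  + exact: S_row.
- by move=> k; rewrite mulr_ge0 // invr_ge0 ltW.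
- by move=> k l kl /=; rewrite ler_wpM2l ?epsN // invr_ge0 ltW.
- under eq_fun do rewrite exprMn.
  by apply: psum_boundedZ => //; rewrite sqr_ge0.
Qed.
End PushSum.

(** * Subgradients of convex functions *)

Section Euclidean.
Variables (R : realType) (m : nat).
Implicit Types u v : 'cV[R]_m.

Lemma dotvC u v : dotv u v = dotv v u.
Proof. by apply: eq_bigr => t _; rewrite mulrC. Qed.

Lemma dotvDl u u' v : dotv (u + u') v = dotv u v + dotv u' v.
Proof.
by rewrite -big_split; apply: eq_bigr => t _ /=; rewrite mxE mulrDl.
Qed.

Lemma dotvZl a u v : dotv (a *: u) v = a * dotv u v.
Proof. by rewrite mulr_sumr; apply: eq_bigr => t _ /=; rewrite mxE mulrA. Qed.

Lemma dotvDr u v v' : dotv u (v + v') = dotv u v + dotv u v'.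
Proof. by rewrite !(dotvC u) dotvDl. Qed.

Lemma dotvZr a u v : dotv u (a *: v) = a * dotv u v.
Proof. by rewrite !(dotvC u) dotvZl. Qed.

Lemma dotv_delta v t : dotv (delta_mx t 0) v = v t 0.
Proof.
rewrite /dotv (bigD1 t) //= mxE !eqxx mul1r big1 ?addr0 // => r rt.
by rewrite mxE (negbTE rt) mul0r.
Qed.

Lemma ler_norm2 u t : `|u t 0| <= norm2 u.
Proof.
rewrite -sqrtr_sqr ler_wsqrtr // /dotv (bigD1 t) //= -expr2 lerDl.
by apply: sumr_ge0 => r _; rewrite -expr2 sqr_ge0.
Qed.

(** Dual to the coordinatewise bounds on subgradients that [ler_norm2] extracts from the Euclidean
    one. *)
Definition norm1 u : R := \sum_(t < m) `|u t 0|.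

Lemma ler_dotv_norm1 (L : R) u v :
  (forall t, `|u t 0| <= L) -> `|dotv u v| <= L * norm1 v.
Proof.
move=> uL; apply: le_trans (ler_norm_sum _ _ _) _; rewrite mulr_sumr.
by apply: ler_sum => t _; rewrite normrM ler_wpM2r.
Qed.
End Euclidean.

Section Subgradient.
Variables (R : realType) (m : nat) (f : 'cV[R]_m -> R).
Hypothesis f_convex : convex_function [set: convex_lmodType _] f.

Lemma convex_ineq (x y : 'cV[R]_m) (a b : R) : 0 <= a -> 0 <= b -> a + b = 1 ->
  f (a *: x + b *: y) <= a * f x + b * f y.
Proof.
move=> a0 b0 ab; have a1 : a <= 1 by lra.
have -> : b = 1 - a by lra.
by have := f_convex (Itv01 a0 a1) (x := x) (y := y) (in_setT _) (in_setT _).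
Qed.

(* Hahn-Banach, one coordinate at a time: a linear minorant of f (x + _) - f x
   on the vectors supported on the first j coordinates extends to j + 1
   coordinates. *)
Lemma subgradient_exists (x : 'cV[R]_m) : exists g, subdifferential f x g.
Proof.
suff ext j : (j <= m)%N -> exists g, forall v : 'cV[R]_m,
    (forall t : 'I_m, (j <= t)%N -> v t 0 = 0) -> dotv g v <= f (x + v) - f x.
  have [g gP] := ext m (leqnn m); exists g => x' /=.
  have := gP (x' - x); rewrite subrKC => /(_ _)/wrap[]; last lra.
  by move=> t; rewrite leqNgt ltn_ord.
elim: j => [_|j IH jm].
  exists 0 => v v0; have -> : v = 0 by apply/matrixP => t a; rewrite ord1 v0 // mxE.
  by rewrite addr0 subrr /dotv big1 // => t _; rewrite mxE mul0r.
have [g gP] := IH (ltnW jm); pose o := Ordinal jm.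
pose e : 'cV[R]_m := delta_mx o 0.
pose V := [set v : 'cV[R]_m | forall t : 'I_m, (j <= t)%N -> v t 0 = 0].
pose p v := f (x + v) - f x.
(* The weights [s / (s + t)] and [t / (s + t)] cancel the [e] components, so convexity compares with
   a point where [g] is already a minorant. *)
have gap v1 v2 t s : V v1 -> V v2 -> 0 < t -> 0 < s ->
    (dotv g v1 - p (v1 - t *: e)) / t <= (p (v2 + s *: e) - dotv g v2) / s.
  move=> V1 V2 t0 s0; have ts0 : 0 < s + t by rewrite addr_gt0.
  rewrite ler_pdivrMr // mulrAC ler_pdivlMr //.
  pose a := s / (s + t); pose b := t / (s + t).
  have a0 : 0 <= a by rewrite divr_ge0 ?ltW.
  have b0 : 0 <= b by rewrite divr_ge0 ?ltW.
  have ab : a + b = 1 by rewrite -mulrDl divff // gt_eqF.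
  have Vab : V (a *: v1 + b *: v2) by move=> r jr; rewrite !mxE V1 ?V2 // !mulr0 addr0.
  have := gP _ Vab; rewrite dotvDr !dotvZr => le1.
  have := convex_ineq (x + (v1 - t *: e)) (x + (v2 + s *: e)) a0 b0 ab.
  have -> : a *: (x + (v1 - t *: e)) + b *: (x + (v2 + s *: e)) =
      x + (a *: v1 + b *: v2).
    apply/matrixP => r c; rewrite !mxE /a /b.
    by field; rewrite gt_eqF.
  move=> le2; have {le1 le2} : a * dotv g v1 + b * dotv g v2 <=
      a * p (v1 - t *: e) + b * p (v2 + s *: e).
    have : a * f x + b * f x = f x by rewrite -mulrDl ab mul1r.
    by rewrite /p !mulrBr; lra.
  have -> : a = (s + t)^-1 * s by rewrite mulrC.
  have -> : b = (s + t)^-1 * t by rewrite mulrC.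
  by rewrite -!mulrA -!mulrDr ler_pM2l ?invr_gt0 //; lra.
have V0 : V 0 by move=> t _; rewrite mxE.
pose Lo := [set r | exists v t, [/\ V v, 0 < t & r = (dotv g v - p (v - t *: e)) / t]].
have LoS : has_sup Lo.
  split; first by exists ((dotv g 0 - p (0 - 1 *: e)) / 1), 0, 1.
  exists ((p (0 + 1 *: e) - dotv g 0) / 1) => _ [v [t [Vv t0 ->]]].
  exact: gap.
pose c := sup Lo.
(* This replaces coordinate [o] of [g] by [c], which separates the lower slopes from the upper
   ones. *)
exists (g + (c - g o 0) *: e) => v' v'0.
pose s := v' o 0; pose v := v' - s *: e.
have Vv : V v.
  move=> t jt; rewrite !mxE eqxx andbT; have [->|to] := eqVneq t o.
    by rewrite mulr1 subrr.
  rewrite mulr0 subr0 v'0 // ltn_neqAle jt andbT.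
  by apply: contra to => /eqP jt'; apply/eqP/val_inj.
have v'E : v' = v + s *: e by rewrite subrK.
suff : dotv g v + s * c <= p v'.
  rewrite dotvDl dotvZl dotv_delta -/s v'E dotvDr dotvZr (dotvC g e) dotv_delta.
  rewrite -v'E /p; lra.
have [s0|s0|s0] := ltgtP s 0.
- have : (dotv g v - p (v - (- s) *: e)) / - s <= c.
    apply: ub_le_sup; first by case: LoS.
    by exists v, (- s); rewrite oppr_gt0.
  rewrite scaleNr opprK -v'E ler_pdivrMr ?oppr_gt0 //; lra.
- have : c <= (p (v + s *: e) - dotv g v) / s.
    apply: ge_sup; first by case: LoS.
    by move=> _ [v1 [t [Vv1 t0 ->]]]; apply: gap.
  rewrite -v'E ler_pdivlMr //; lra.
- have := gP v Vv; rewrite v'E s0 scale0r addr0 mul0r addr0; exact.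
Qed.

(** Evaluate at [y] a subgradient taken at [x]; its existence turns the bound on subgradients into a
    Lipschitz bound. *)
Lemma convex_lipschitz (L : R) :
  (forall x g, subdifferential f x g -> norm2 g <= L) ->
  forall x y, f x - f y <= L * norm1 (x - y).
Proof.
move=> fL x y; have [g gP] := subgradient_exists x.
have gL t : `|g t 0| <= L by rewrite (le_trans (ler_norm2 _ _)) ?(fL x).
have := ler_dotv_norm1 (x - y) gL; rewrite ler_norml => /andP[_].
have := gP y; rewrite -opprB -scaleN1r dotvZr; lra.
Qed.
End Subgradient.

(** Compactness of a box, applied to row vectors, hence the transposes. *)
Lemma cluster_point (R : realType) (m : nat) (u : nat -> 'cV[R]_m) (B : R) :
  (forall k t, `|u k t 0| <= B) ->
  exists s : 'cV[R]_m, forall e n, 0 < e ->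
    exists2 k, (n <= k)%N & forall t, `|u k t 0 - s t 0| < e.
Proof.
move=> uB.
have := @rV_compact R m (fun=> `[- B, B]%classic) (fun=> @segment_compact R _ _).
move=> /(_ ((fun k => (u k)^T) @ \oo) _)[].
  exists 0%N => // k _ t /=; rewrite mxE in_itv /=.
  by rewrite -ler_norml.
move=> s [_ cl]; exists s^T => e n e0.
have [] := cl ((fun k => (u k)^T) @` [set k | (n <= k)%N]) (ball s e) _
  (nbhsx_ballx _ _ e0).
  by exists n => // k nk; exists k.
move=> _ [[k nk <-] sk]; exists k => // t; rewrite mxE.
by have [_ /(_ 0 t)] := sk; rewrite mxE /ball /= distrC.
Qed.

(** * Convergence of the averages *)

Section QuasiFejer.
Variables (R : realType) (V h b gamma : nat -> R).
Hypothesis V_ge0 : forall k, 0 <= V k.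
Hypothesis h_ge0 : forall k, 0 <= h k.
Hypothesis gamma_gt0 : forall k, 0 < gamma k.
Hypothesis b_ge0 : forall k, 0 <= b k.
Hypothesis b_bounded : psum_bounded b.
Hypothesis V_step : forall k, V k.+1 <= V k - gamma k * h k + b k.

Lemma quasi_fejer_sum m n : (m <= n)%N ->
  V n + \sum_(m <= k < n) gamma k * h k <= V m + \sum_(m <= k < n) b k.
Proof.
elim: n => [|n IH]; first by rewrite leqn0 => /eqP ->; rewrite !big_geq.
rewrite leq_eqVlt => /predU1P[->|mn]; first by rewrite !big_geq.
by rewrite !big_nat_recr //=; have := IH mn; have := V_step n; lra.
Qed.

Lemma quasi_fejer_le m n : (m <= n)%N -> V n <= V m + \sum_(m <= k < n) b k.
Proof.
move=> mn; apply: le_trans (quasi_fejer_sum mn); rewrite lerDl sumr_ge0 // => k _.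
by rewrite mulr_ge0 // ltW.
Qed.

Lemma quasi_fejer_bounded : exists B, forall n, V n <= B.
Proof.
have [B bB] := b_bounded; exists (V 0%N + B) => n.
by apply: le_trans (quasi_fejer_le (leq0n n)) _; rewrite lerD2l.
Qed.

Lemma quasi_fejer_liminf (e : R) m : (series gamma @ \oo --> +oo) -> 0 < e ->
  exists2 k, (m <= k)%N & h k < e.
Proof.
move=> gammaoo e0; apply: contrapT => /forall2NP hk.
have he k : (m <= k)%N -> e <= h k.
  by move=> mk; have [|/negP] := hk k; [move/negP; rewrite mk|rewrite -leNgt].
have [B bB] := b_bounded.
(* With [h k >= e] from [m] on, step sizes summing to [(V m + B) / e + 1] after [m] would cost more
   than the available [V m + B]. *)
pose M := \sum_(0 <= k < m) gamma k + (V m + B) / e + 1.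
move/cvgryPge : gammaoo => /(_ M)[n0 _ n0M].
have := n0M (maxn n0 m) (leq_maxl _ _); set n := maxn n0 m => /= Mn.
have mn : (m <= n)%N by rewrite leq_maxr.
have := quasi_fejer_sum mn.
have : \sum_(m <= k < n) e * gamma k <= \sum_(m <= k < n) gamma k * h k.
  by apply: ler_sum_nat => k /andP[mk _]; rewrite mulrC ler_pM2l ?he.
have : \sum_(m <= k < n) b k <= B.
  apply: le_trans (bB n); rewrite (big_cat_nat (leq0n m) mn) /=.
  by rewrite lerDr sumr_ge0.
have : (V m + B) / e + 1 <= \sum_(m <= k < n) gamma k.
  by move: Mn; rewrite /series /= (big_cat_nat (leq0n m) mn) /= /M; lra.
rewrite -(ler_pM2l e0) mulr_sumr mulrDr mulrCA divff ?gt_eqF // !mulr1.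
by have := V_ge0 n; lra.
Qed.

(** Beyond an index where the tail of [b] is below [e / 2], a single visit of [V] below [e / 2]
    keeps it below [e] forever. *)
Lemma quasi_fejer_cvg0 : (forall e m, 0 < e -> exists2 k, (m <= k)%N & V k < e) ->
  forall e, 0 < e -> exists m, forall k, (m <= k)%N -> V k < e.
Proof.
move=> V0 e e0; have e20 : 0 < e / 2 by rewrite divr_gt0.
have [m me] := psum_bounded_tail b_ge0 b_bounded e20.
have [k mk Vk] := V0 _ m e20; exists k => n kn.
apply: le_lt_trans (quasi_fejer_le kn) _.
have := me n (leq_trans mk kn); rewrite (big_cat_nat mk kn) /=.
have : 0 <= \sum_(m <= i < k) b i by rewrite sumr_ge0.
lra.
Qed.
End QuasiFejer.

(** * Subgradient steps evaluated at nearby points *)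

Section ApproximateSubgradientMethod.
Variables (R : realType) (m N : nat) (f : 'I_N -> 'cV[R]_m -> R) (L : R).
Variables (c : 'I_m -> R) (gamma : nat -> R).
Variables (X : nat -> 'cV[R]_m) (Y G : nat -> 'I_N -> 'cV[R]_m).
Hypothesis f_convex : forall i, convex_function [set: convex_lmodType _] (f i).
Hypothesis f_subgrad : forall i x g, subdifferential (f i) x g -> norm2 g <= L.
Hypothesis L_gt0 : 0 < L.
Hypothesis c_ge1 : forall t, 1 <= c t.
Hypothesis gamma_gt0 : forall k, 0 < gamma k.
Hypothesis gamma_oo : series gamma @ \oo --> +oo.
Hypothesis gamma_sqr : psum_bounded (fun k => gamma k ^+ 2).
Hypothesis G_subgrad : forall k i, subdifferential (f i) (Y k i) (G k i).
Hypothesis X_step : forall k t,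
  X k.+1 t 0 = X k t 0 - gamma k / c t * \sum_(i < N) G k i t 0.
Hypothesis XY : forall i t, psum_bounded (fun k => (X k t 0 - Y k i t 0) ^+ 2).

Let F (x : 'cV[R]_m) := \sum_(i < N) f i x.
(** The weight [c t] cancels the division by [c t] in the step, leaving an unweighted inner product
    as the cross term. *)
Let V (s : 'cV[R]_m) k := \sum_(t < m) c t * (X k t 0 - s t 0) ^+ 2.
Let err k := \sum_(i < N) norm1 (X k - Y k i).
(** Each [f i] pays [L * norm1 (X k - Y k i)] twice, for moving its value and for moving the base
    point of its subgradient; the cross term doubles this again. The last term is the squared
    step. *)
Let b k := 4 * L * (gamma k * err k) + m%:R * (N%:R * L) ^+ 2 * gamma k ^+ 2.

Lemma subgrad_le k i t : `|G k i t 0| <= L.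
Proof. exact: le_trans (ler_norm2 _ _) (f_subgrad (G_subgrad k i)). Qed.

Lemma lyapunov_expand s k : V s k.+1 <= V s k -
  2 * gamma k * \sum_(i < N) dotv (G k i) (X k - s)
  + m%:R * (N%:R * L) ^+ 2 * gamma k ^+ 2.
Proof.
rewrite exchange_big /= mulr_sumr -sumrB.
have -> : m%:R * (N%:R * L) ^+ 2 * gamma k ^+ 2 =
    \sum_(t < m) (N%:R * L) ^+ 2 * gamma k ^+ 2.
  by rewrite sumr_const card_ord -mulrA mulr_natl.
rewrite -big_split /=; apply: ler_sum => t _; rewrite -mulr_suml X_step !mxE.
have c0 : 0 < c t by rewrite (lt_le_trans ltr01).
set S := \sum_(i < N) G k i t 0; set d := X k t 0 - s t 0.
have SL : S ^+ 2 <= (N%:R * L) ^+ 2.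
  rewrite -(real_normK (num_real S)) ler_sqr ?nnegrE ?mulr_ge0 ?(ltW L_gt0) //.
  apply: le_trans (ler_norm_sum _ _ _) _.
  rewrite mulr_natl -[X in L *+ X]card_ord -sumr_const.
  by apply: ler_sum => i _; exact: subgrad_le.
have -> : c t * (X k t 0 - gamma k / c t * S - s t 0) ^+ 2 =
    c t * d ^+ 2 - 2 * gamma k * (S * d) + (S ^+ 2 / c t) * gamma k ^+ 2.
  by rewrite /d; field; rewrite gt_eqF.
rewrite lerD2l ler_wpM2r ?sqr_ge0 // ler_pdivrMr //.
by apply: le_trans SL _; rewrite ler_peMr ?sqr_ge0.
Qed.

Lemma lyapunov_step s k : V s k.+1 <= V s k - gamma k * (2 * (F (X k) - F s)) + b k.
Proof.
have g0 := gamma_gt0 k.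
suff : F (X k) - F s - 2 * L * err k <= \sum_(i < N) dotv (G k i) (X k - s).
  rewrite -(ler_pM2l g0); have := lyapunov_expand s k; rewrite /b; lra.
rewrite /F /err mulr_sumr -!sumrB; apply: ler_sum => i _.
have := G_subgrad k i s.
have -> : s - Y k i = (X k - Y k i) + (-1) *: (X k - s).
  by apply/matrixP => u v; rewrite !mxE; ring.
rewrite dotvDr dotvZr.
have := convex_lipschitz (f_convex i) (f_subgrad (i := i)) (X k) (Y k i).
have := ler_dotv_norm1 (X k - Y k i) (subgrad_le k i).
rewrite ler_norml => /andP[+ _].
lra.
Qed.

(** The products [gamma k * err k] are dominated by sums of [gamma k ^+ 2] and squared distances, as
    [x * y <= x ^+ 2 + y ^+ 2]. *)
Lemma perturbation_bounded : psum_bounded b.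
Proof.
apply: psum_boundedD; last first.
  by apply: psum_boundedZ gamma_sqr; rewrite mulr_ge0 ?sqr_ge0.
apply: psum_boundedZ; first by rewrite mulr_ge0 // ltW.
have -> : (fun k => gamma k * err k) =
    fun k => \sum_(i < N) \sum_(t < m) gamma k * `|X k t 0 - Y k i t 0|.
  apply: funext => k; rewrite /err /norm1 mulr_sumr; apply: eq_bigr => i _.
  by rewrite mulr_sumr; apply: eq_bigr => t _; rewrite !mxE.
apply: psum_bounded_sum => i _; apply: psum_bounded_sum => t _.
apply: psum_bounded_le (psum_boundedD gamma_sqr (XY i t)) => k /=.
rewrite -(real_normK (num_real (X k t 0 - Y k i t 0))).
set x := gamma k; set y := `|_|.
have : 0 <= y by rewrite normr_ge0.
have : 0 < x by exact: gamma_gt0.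
have : 0 <= (x - y) ^+ 2 by rewrite sqr_ge0.
rewrite !expr2. nra.
Qed.

Lemma approximate_subgradient_cvg : minimizers F !=set0 ->
  exists2 s, minimizers F s &
    forall e : R, 0 < e -> exists K, forall k t, (K <= k)%N -> `|X k t 0 - s t 0| < e.
Proof.
case=> s0 s0min.
have err0 k : 0 <= err k by rewrite sumr_ge0 // => i _; rewrite sumr_ge0.
have b0 k : 0 <= b k.
  by rewrite addr_ge0 ?mulr_ge0 ?sqr_ge0 // ltW.
have V0 s k : 0 <= V s k.
  by rewrite sumr_ge0 // => t _; rewrite mulr_ge0 ?sqr_ge0 // (le_trans ler01).
have h0 s k : minimizers F s -> 0 <= 2 * (F (X k) - F s).
  by move=> smin; rewrite mulr_ge0 // subr_ge0; apply: smin.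
have le_V (s : 'cV[R]_m) k t : (X k t 0 - s t 0) ^+ 2 <= V s k.
  rewrite /V (bigD1 t) //= -[leLHS]addr0 lerD ?ler_peMl ?sqr_ge0 //.
  by rewrite sumr_ge0 // => r _; rewrite mulr_ge0 ?sqr_ge0 // (le_trans ler01).
have liminf (e : R) n := @quasi_fejer_liminf _ _ _ _ _ (V0 s0) gamma_gt0 b0
  perturbation_bounded (lyapunov_step s0) e n gamma_oo.
have [B VB] := quasi_fejer_bounded (fun k => h0 s0 k s0min)
  gamma_gt0 perturbation_bounded (lyapunov_step s0).
(* A sequence of indices along which the values tend to the minimum; the cluster point is taken
   along it. *)
have /choice[kk kkP] l : exists k, (l <= k)%N /\ 2 * (F (X k) - F s0) < l.+1%:R^-1.
  by have [|k] := liminf l.+1%:R^-1 l; [rewrite invr_gt0 | exists k].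
have X_bounded k t : `|X (kk k) t 0| <= B + 1 + norm1 s0.
  have sq : `|X (kk k) t 0 - s0 t 0| ^+ 2 <= B.
    by rewrite real_normK ?num_real //; apply: le_trans (le_V s0 _ t) (VB _).
  have : `|s0 t 0| <= norm1 s0 by rewrite /norm1 (bigD1 t) //= lerDl sumr_ge0.
  have := ler_normD (X (kk k) t 0 - s0 t 0) (s0 t 0); rewrite subrK.
  have : 0 <= (`|X (kk k) t 0 - s0 t 0| - 1) ^+ 2 by rewrite sqr_ge0.
  have := normr_ge0 (X (kk k) t 0 - s0 t 0).
  rewrite !expr2 in sq *; nra.
have [s sP] := cluster_point X_bounded.
have F_le (x y : 'cV[R]_m) d : (forall t, `|x t 0 - y t 0| < d) ->
    F y <= F x + N%:R * L * m%:R * d.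
  move=> xyd; rewrite -lerBlDl -sumrB.
  have -> : N%:R * L * m%:R * d = \sum_(i < N) L * (m%:R * d).
    by rewrite sumr_const card_ord -[RHS]mulr_natl !mulrA.
  apply: ler_sum => i _.
  apply: le_trans (convex_lipschitz (f_convex i) (f_subgrad (i := i)) y x) _.
  rewrite ler_pM2l // mulr_natl -[X in d *+ X]card_ord -sumr_const.
  by apply: ler_sum => t _; rewrite !mxE distrC ltW.
have s_min : minimizers F s.
  move=> x; apply: le_trans (s0min x); apply/ler_addgt0Pr => e e0.
  pose C := N%:R * L * m%:R.
  have C0 : 0 <= C by rewrite !mulr_ge0 // ltW.
  have e20 : 0 < e / 2 by rewrite divr_gt0.
  (* At this radius the Lipschitz term [C * d] is at most [e / 2]; the [+ 1] allows [C = 0]. *)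
  have d0 : 0 < e / 2 / (C + 1) by rewrite divr_gt0 // ltr_wpDl.
  have [n _ nP] := near_infty_natSinv_lt (PosNum e20).
  have [l nl lP] := sP _ n d0.
  have := F_le _ _ _ lP; have [_] := kkP l; have /= := nP l nl.
  have : C * (e / 2 / (C + 1)) <= e / 2.
    rewrite mulrCA ler_piMr ?(ltW e20) // ler_pdivrMr ?ltr_wpDl //; lra.
  rewrite -/C; move: (C * _)
    (l.+1%:R^-1) (F s) (F s0) (F (X (kk l))) => *; lra.
exists s => // e e0.
have V_small d n : 0 < d -> exists2 k, (n <= k)%N & V s k < d.
  move=> d0; pose C := \sum_(t < m) c t.
  have C0 : 0 <= C by rewrite sumr_ge0 // => t _; rewrite (le_trans ler01).
  have C10 : 0 < C + 1 by rewrite ltr_wpDl.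
  (* The cap at 1 lets squares of deviations below [r] be bounded by [r] itself. *)
  pose r := Num.min 1 (d / (C + 1)).
  have r0 : 0 < r by rewrite lt_min ltr01 divr_gt0.
  have [l nl lP] := sP _ n r0; exists (kk l).
    by apply: leq_trans nl _; case: (kkP l).
  have r1 : r <= 1 by rewrite ge_min lexx.
  have : (C + 1) * r <= d by rewrite mulrC -ler_pdivlMr // ge_min lexx orbT.
  suff : V s (kk l) <= C * r by nra.
  rewrite /V mulr_suml; apply: ler_sum => t _.
  rewrite ler_wpM2l ?(le_trans ler01) // -(real_normK (num_real _)).
  have := lP t; have := normr_ge0 (X (kk l) t 0 - s t 0); rewrite expr2; nra.
(* The quasi-Fejér argument is run again, now relative to the cluster point [s]. *)
have [K KP] := quasi_fejer_cvg0 (fun k => h0 s k s_min) gamma_gt0 b0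
  perturbation_bounded (lyapunov_step s) V_small (exprn_gt0 2 e0).
exists K => k t Kk; rewrite -(ltr_pXn2r (n := 2)) ?nnegrE ?(ltW e0) //.
rewrite real_normK ?num_real //.
exact: le_lt_trans (le_V s k t) (KP k Kk).
Qed.
End ApproximateSubgradientMethod.

(** * Stacked estimates *)

Lemma dotv_mxcol (R : realType) (P : nat) (n : 'I_P -> nat)
    (u v : forall p, 'cV[R]_(n p)) :
  dotv (\mxcol_p u p) (\mxcol_p v p) = \sum_p dotv (u p) (v p).
Proof.
have dotvE m (a b : 'cV[R]_m) : dotv a b = (a^T *m b) 0 0.
  by rewrite mxE; apply: eq_bigr => t _; rewrite mxE.
rewrite dotvE tr_mxcol mul_mxrow_mxcol summxE.
by apply: eq_bigr => p _; rewrite dotvE.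
Qed.

Section Blocks.
Variables (R : realType) (P : nat) (n : 'I_P -> nat).

Lemma colsetB (A : {set 'I_P}) (u v : forall p, 'cV[R]_(n p)) :
  colset A u - colset A v = colset A (fun p => u p - v p).
Proof. by apply/matrixP => t c; rewrite !mxE. Qed.

Lemma eq_colset (A : {set 'I_P}) (u v : forall p, 'cV[R]_(n p)) :
  (forall p, p \in A -> u p = v p) -> colset A u = colset A v.
Proof. by move=> uv; apply: eq_mxcol => a; rewrite uv ?enum_valP. Qed.

(** Since [f] ignores the blocks outside [A], the point may be completed by any blocks there, and
    the subgradient by zeros. *)
Lemma subdifferential_fun_on (f : 'cV[R]_(\sum_p n p) -> R) (A B : {set 'I_P})
    (y g : forall p, 'cV[R]_(n p)) (x : 'cV[R]_(\sum_p n p)) :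
  B \subset A -> depends_only_on f B ->
  subdifferential (fun_on f (A := A)) (colset A y) (colset A g) ->
  subdifferential f (\mxcol_p if p \in A then y p else submxcol x p)
    (\mxcol_p if p \in A then g p else 0).
Proof.
move=> BA fB fg x' /=.
set Y := (\mxcol_p if p \in A then y p else submxcol x p).
have yY : colset A y = colset A (fun p => submxcol Y p).
  by apply: eq_colset => p pA; rewrite mxcolK pA.
have := fg (colset A (fun p => submxcol x' p)).
rewrite yY !(fun_onE _ BA fB) colsetB; congr (_ + _ <= _).
rewrite /colset dotv_mxcol -[x' - Y]submxcolK dotv_mxcol.
rewrite -(big_enum_val (fun p => dotv (g p) (submxcol x' p - submxcol Y p))) big_mkcond.
apply: eq_bigr => p _ /=.
have -> : submxcol (x' - Y) p = submxcol x' p - submxcol Y p.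
  by apply/matrixP => t c; rewrite !mxE.
by case: ifP => // _; rewrite /dotv big1 // => t _; rewrite mxE mul0r.
Qed.
End Blocks.

Lemma cvg_series_psum_bounded (R : realType) (a : nat -> R) :
  (forall k, 0 <= a k) -> cvgn (series a) -> psum_bounded a.
Proof.
move=> a0 acv; exists (limn (series a)) => m.
by apply: nondecreasing_cvgn_le => //; apply: nondecreasing_series.
Qed.
Theorem theorem2 (R : realType) (N P : nat) (n : 'I_P -> nat)
    (EI EE : {set 'I_P * 'I_N})
    (EC : nat -> {set 'I_N * 'I_N})
    (ED : nat -> 'I_P -> {set 'I_N * 'I_N})
    (W : nat -> 'I_P -> 'M[R]_N)
    (f : 'I_N -> 'cV[R]_(\sum_(p < P) n p) -> R)
    (nu L : R) (Q : nat) (gamma : nat -> R)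
    (q : nat -> 'I_N -> 'I_P -> R)
    (w z y g : nat -> 'I_N -> forall p : 'I_P, 'cV[R]_(n p)) :
  let F := fun x : 'cV[R]_(\sum_(p < P) n p) => \sum_(i < N) f i x in
  (* interference and estimate graphs, problem *)
  (forall i, depends_only_on (f i) (comps_of EI i)) ->
  (forall p, exists i, (p, i) \in EI) ->
  EI \subset EE ->
  minimizers F !=set0 ->
  (* design graphs and weights *)
  (forall k p, ED k p \subset finset.setX (agents_of EE p) (agents_of EE p)) ->
  (forall k p, ED k p \subset EC k) ->
  (forall k p, compliant (agents_of EE p) (ED k p) (W k p)) ->
  (forall k p i, i \in agents_of EE p -> (i, i) \in ED k p) ->
  (forall k p, column_stochastic (agents_of EE p) (W k p)) ->
  0 < nu ->
  (forall k p i j, (j, i) \in ED k p -> nu <= W k p i j) ->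
  (0 < Q)%N ->
  (forall p, Q_strongly_connected Q (agents_of EE p) (fun k => ED k p)) ->
  (* costs and step sizes *)
  (forall i, convex_function [set: convex_lmodType _] (f i)) ->
  0 < L ->
  (forall i x s, subdifferential (f i) x s -> norm2 s <= L) ->
  (forall k, 0 < gamma k) ->
  nonincreasing_seq gamma ->
  (series gamma @ \oo --> +oo) ->
  cvgn (series (fun k => gamma k ^+ 2)) ->
  (* algorithm *)
  (forall i p, (p, i) \in EE -> q 0%N i p = 1) ->
  (forall k i p, (p, i) \in EE ->
     q k.+1 i p = \sum_(j in agents_of EE p) W k p i j * q k j p) ->
  (forall k i p, (p, i) \in EE ->
     w k.+1 i p = \sum_(j in agents_of EE p) W k p i j *: z k j p) ->
  (forall k i p, (p, i) \in EE -> y k.+1 i p = (q k.+1 i p)^-1 *: w k.+1 i p) ->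
  (forall k i,
     subdifferential (fun_on (f i) (A := comps_of EE i))
       (colset (comps_of EE i) (y k.+1 i)) (colset (comps_of EE i) (g k.+1 i))) ->
  (forall k i p, (p, i) \in EE ->
     z k.+1 i p = w k.+1 i p - gamma k *: g k.+1 i p) ->
  exists2 ystar, minimizers F ystar &
    (fun k => stack EE (y k)) @ \oo --> consensus EE ystar.
Proof.
move=> F fI fI' EIE Fmin EDsub _ Wc loops Wcol nu0 Wnu Q0 Qsc fconv L0 fL g0 gN goo g2
  q0 qS wS yS gS zS.
set d := (\sum_(p < P) n p)%N.
pose A p := agents_of EE p.
have inA p i : (i \in A p) = ((p, i) \in EE) by rewrite inE.
pose avg k p : 'cV[R]_(n p) := #|A p|%:R^-1 *: \sum_(j in A p) z k j p.
pose X k : 'cV[R]_d := \mxcol_p avg k p.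
(* Indices are offset because [y k.+1] is computed from [z k]. Blocks that agent [i] does not hold
   are copied from [X k], so they add no deviation. *)
pose Y k i : 'cV[R]_d :=
  \mxcol_p if p \in comps_of EE i then y k.+1 i p else submxcol (X k) p.
pose G k i : 'cV[R]_d := \mxcol_p if p \in comps_of EE i then g k.+1 i p else 0.
have A0 p : (0 < #|A p|)%N.
  have [i pi] := fI' p; apply/card_gt0P; exists i.
  by rewrite inA (fintype.subsetP EIE).
have GY k i : subdifferential (f i) (Y k i) (G k i).
  apply: subdifferential_fun_on (gS k i); last exact: fI.
  by apply/fintype.subsetP => p; rewrite !inE; apply: (fintype.subsetP EIE).
have GL k i t : `|G k i t 0| <= L.
  exact: le_trans (ler_norm2 _ _) (fL _ _ _ (GY k i)).
have g2' : psum_bounded (fun k => gamma k ^+ 2).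
  by apply: cvg_series_psum_bounded => // k; rewrite sqr_ge0.
have XY i t : psum_bounded (fun k => (X k t 0 - Y k i t 0) ^+ 2).
  pose p := tagnat.sig1 t; pose r := tagnat.sig2 t.
  case: (boolP ((p, i) \in EE)) => [piE|piE]; last first.
    exists 0 => m; rewrite big1 // => k _.
    have -> : Y k i t 0 = X k t 0.
      by rewrite /Y mxE inE (negbTE piE) /X mxcolK [RHS]mxE.
    by rewrite subrr expr0n.
  have -> : (fun k => (X k t 0 - Y k i t 0) ^+ 2) = (fun k =>
      (#|A p|%:R^-1 * \sum_(j in A p) z k j p r 0 - y k.+1 i p r 0) ^+ 2).
    by apply: funext => k; rewrite !mxE inE piE summxE.
  have [WA col wnu] : [/\ forall k, compliant (A p) (ED k p) (W k p),
      forall k, column_stochastic (A p) (W k p) &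
      forall k i j, (j, i) \in ED k p -> nu <= W k p i j].
    by split=> k; [exact: Wc|exact: Wcol|exact: Wnu].
  have wE k j : j \in A p ->
      w k.+1 j p r 0 = \sum_(a in A p) W k p j a * z k a p r 0.
    rewrite inA => pj; rewrite wS // summxE.
    by apply: eq_bigr => a _; rewrite mxE.
  (* Applied to one coordinate at a time; the mixing error is [gamma k] times a subgradient entry,
     hence at most [gamma k * L]. *)
  apply: (@pushsum_consensus R N (A p) (fun k => ED k p) Q nu (fun k => W k p)
    (EDsub ^~ p) (fun k => loops k p) (Qsc p) Q0 nu0 WA col wnu (fun k j => q k j p)
    _ _ (fun k j => z k j p r 0) (fun k j => y k j p r 0) (fun k => gamma k * L)).
  - by move=> j; rewrite inA; apply: q0.
  - by move=> k j; rewrite inA; apply: qS.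
  - by move=> k; rewrite mulr_ge0 // ltW.
  - by move=> k l kl /=; rewrite ler_pM2r // gN.
  - have -> : (fun k => (gamma k * L) ^+ 2) = (fun k => L ^+ 2 * gamma k ^+ 2).
      by apply: funext => k; rewrite mulrC exprMn.
    by apply: psum_boundedZ => //; rewrite sqr_ge0.
  - by move=> k j jA; rewrite -wE // yS -?inA // mxE.
  - move=> k j jA; rewrite -wE // zS -?inA // !mxE addrAC subrr add0r normrN normrM.
    rewrite (gtr0_norm (g0 k)) ler_pM2l //.
    by have := GL k j t; rewrite mxE inE -inA jA.
  - by rewrite inA.
have Xstep k t : X k.+1 t 0 = X k t 0 - gamma k / #|A (tagnat.sig1 t)|%:R *
    \sum_(i < N) G k i t 0.
  pose p := tagnat.sig1 t; pose r := tagnat.sig2 t.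
  have -> : \sum_(i < N) G k i t 0 = \sum_(i in A p) g k.+1 i p r 0.
    rewrite [RHS]big_mkcond; apply: eq_bigr => i _.
    by rewrite mxE inE inA; case: ifP => // _; rewrite mxE.
  (* Column stochasticity makes the mixing preserve the sum over agents, so only the subgradients
     move it. *)
  have zE : \sum_(j in A p) z k.+1 j p = \sum_(j in A p) z k j p
      - gamma k *: \sum_(j in A p) g k.+1 j p.
    under eq_bigr => j pj do rewrite zS -?inA //.
    rewrite sumrB -scaler_sumr; congr (_ - _).
    under eq_bigr => j pj do rewrite wS -?inA //.
    rewrite exchange_big /=; apply: eq_bigr => j jA.
    by rewrite -scaler_suml (Wcol k p j jA) scale1r.
  rewrite !mxE zE !mxE !summxE mulrBr -!/p; congr (_ - _).
  by rewrite mulrCA mulrA.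
have c1 (t : 'I_d) : 1 <= #|A (tagnat.sig1 t)|%:R :> R by rewrite ler1n.
have [s smin sP] :=
  approximate_subgradient_cvg fconv fL L0 c1 g0 goo g2' GY Xstep XY Fmin.
(* The shift drops [y 0], which the algorithm does not determine, and aligns [y k.+1] with [X k]. *)
exists s => //; rewrite -cvg_shiftS; apply/cvg_ballP => e e0.
have e20 : 0 < e / 2 by rewrite divr_gt0.
have [K KP] := sP _ e20.
have near_all : \forall k \near \oo, forall (i : 'I_N) (t : 'I_d),
    `|X k t 0 - Y k i t 0| < e / 2.
  apply: filter_forall => i; apply: filter_forall => t.
  have sq0 k : 0 <= (X k t 0 - Y k i t 0) ^+ 2 by rewrite sqr_ge0.
  have [m mP] := psum_bounded_small sq0 (XY i t) (exprn_gt0 2 e20).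
  exists m => // k /mP small; rewrite -(ltr_pXn2r (n := 2)) ?nnegrE ?(ltW e20) //.
  by rewrite real_normK ?num_real.
near=> k.
have kXY : forall i t, `|X k t 0 - Y k i t 0| < e / 2 by near: k.
have kK : (K <= k)%N by near: k; exists K.
split=> // a b.
(* An index of the stack decodes into a component [p], an agent [i] and a coordinate [r]; [t] is the
   matching index in the optimization variable. *)
pose p := tagnat.sig1 a; pose i := enum_val (tagnat.sig1 (tagnat.sig2 a)).
pose r := tagnat.sig2 (tagnat.sig2 a); pose t : 'I_d := tagnat.Rank p r.
have iA : i \in A p by apply: enum_valP.
rewrite ord1 /ball /= !mxE -/t.
have -> : y k.+1 i p r 0 = Y k i t 0.
  have /(congr1 (fun u : 'cV[R]_(n p) => u r 0)) : submxcol (Y k i) p = y k.+1 i p.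
    by rewrite mxcolK inE -inA iA.
  by rewrite mxE.
have := kXY i t; have := KP k t kK.
have := ler_distD (X k t 0) (s t 0) (Y k i t 0).
rewrite (distrC (s t 0) (X k t 0)); lra.
Unshelve. all: end_near.
Qed.
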